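(* Let $p\ge2$, let $f\in\mathcal H_0$, let $u$ solve the gradient flow $\partial_tu+\partial J(u)\ni0$, $u(0)=f$, set $\lambda:=\lambda_1\|f\|^{p-2}$, let $a(t)=(1+(p-2)\lambda t)^{-\frac1{p-2}}$ if $p>2$ and $a(t)=e^{-\lambda t}$ if $p=2$, and let $w(t):=u(t)/a(t)$ for $t\ge0$. Assume that there are $w_*\in\mathcal H$ and a sequence $t_k\to\infty$ with $w(t_k)\to w_*$ strongly in $\mathcal H$ (or that $w(t)\to w_*$ strongly as $t\to\infty$). Then $\lambda w_*\in\partial J(w_* )$, and $w_*\ne0$ if $p>2$.
   Context: $\mathcal H$ is a real Hilbert space with inner product $\langle\cdot,\cdot\rangle$ and norm $\|\cdot\|$. $J:\mathcal H\to\mathbb R\cup\{\infty\}$ is convex, lower semicontinuous, proper, with dense effective domain, and absolutely $p$-homogeneous: $J(cu)=|c|^pJ(u)$ for $c\ne0$ and $J(0)=0$. Standing coercivity assumption: $\lambda_1:=\inf_{u\in\mathcal H_0}pJ(u)/\|u\|^p>0$. $\partial J(u)=\{\zeta: J(u)+\langle\zeta,v-u\rangle\le J(v)\ \forall v\}$; $\mathcal N(J)=\{u:J(u)=0\}$; $\mathcal H_0:=\mathcal N(J)^\perp\setminus\{0\}$. The gradient flow solution (Brezis) is the unique continuous $u:[0,\infty)\to\mathcal H$, Lipschitz on $[\delta,\infty)$ for all $\delta>0$, right-differentiable on $(0,\infty)$ with $u(0)=f$ and $\partial_t^+u(t)=-\zeta(t)$, $\zeta(t)$ the minimal-norm element of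 $\partial J(u(t))$. The function $a$ is the solution of $a'=-\lambda a^{p-1}$, $a(0)=1$. *)

(* Defs.v *)
From HB Require Import structures.
From mathcomp Require Import all_boot all_order all_algebra.
From mathcomp Require Import all_classical all_reals all_analysis.
Set Implicit Arguments. Unset Strict Implicit. Unset Printing Implicit Defensive.
Import Order.TTheory GRing.Theory Num.Theory.
Import numFieldNormedType.Exports.
Local Open Scope classical_set_scope.
Local Open Scope ring_scope.

Section Defs.
Context {R : realType} {H : normedModType R}.

Definition inner_product (ip : H -> H -> R) : Prop :=
  (forall x y, ip x y = ip y x) /\
  (forall (c : R) x y z, ip (c *: x + y) z = c * ip x z + ip y z) /\
  (forall x, ip x x = `|x| ^+ 2).

Local Open Scope ereal_scope.

Definition convex_ext (J : H -> \bar R) : Prop :=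
  forall (x y : H) (t : R), (0 < t < 1)%R ->
    J (t *: x + (1 - t) *: y)%R <= t%:E * J x + (1 - t)%:E * J y.

Definition proper_ext (J : H -> \bar R) : Prop :=
  (forall x, J x != -oo) /\ (exists x, J x \is a fin_num).

Definition dom (J : H -> \bar R) : set H := [set x | J x \is a fin_num].

Definition dense_dom (J : H -> \bar R) : Prop := closure (dom J) = setT.

Definition abs_p_homogeneous (p : R) (J : H -> \bar R) : Prop :=
  (forall (c : R) x, c != 0%R -> J (c *: x)%R = (powR `|c| p)%:E * J x) /\
  J 0%R = 0.

Definition subdiff (ip : H -> H -> R) (J : H -> \bar R) (u : H) : set H :=
  [set zeta | forall v, J u + (ip zeta (v - u)%R)%:E <= J v].

Definition nullset (J : H -> \bar R) : set H := [set u | J u = 0].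

Definition H0 (ip : H -> H -> R) (J : H -> \bar R) : set H :=
  [set u | (forall v, nullset J v -> ip u v = 0%R) /\ u != (0%R : H)].

Definition lambda1_ext (ip : H -> H -> R) (p : R) (J : H -> \bar R) : \bar R :=
  ereal_inf [set p%:E * J u * ((powR (@Num.norm _ H u) p)^-1)%R%:E | u in H0 ip J].

Local Close Scope ereal_scope.

Definition min_norm_subgrad (ip : H -> H -> R) (J : H -> \bar R) (v zeta : H) :=
  subdiff ip J v zeta /\ (forall eta, subdiff ip J v eta -> `|zeta| <= `|eta|).

(* Brezis gradient-flow solution of  d_t u + dJ(u) \ni 0, u(0) = f,
   with u viewed as a function R -> H, only its values on [0,oo) mattering *)
Definition gradient_flow (ip : H -> H -> R) (J : H -> \bar R) (f : H)
    (u : R -> H) : Prop :=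
  {within [set t : R | 0 <= t], continuous u} /\
  (forall delta : R, 0 < delta -> exists L : R, forall s t : R,
     delta <= s -> delta <= t -> `|u s - u t| <= L * `|s - t|) /\
  u 0 = f /\
  (forall t : R, 0 < t -> exists zeta : H,
     min_norm_subgrad ip J (u t) zeta /\
     (fun h : R => h^-1 *: (u (t + h) - u t)) @ 0^'+ --> - zeta).

End Defs.

Definition a_fun {R : realType} (p lam t : R) : R :=
  if 2 < p then powR (1 + (p - 2) * lam * t) (- (p - 2)^-1) else expR (- (lam * t)).

(* Main.v *)
(** In the time tau with t = theta(tau), where theta' = exp ((p - 2) lam tau),
    the weight a becomes exp (- lam tau), and w solves w' = lam w - zeta with
    zeta in dJ(w): the gradient flow of E(v) = J(v) - lam / 2 |v|^2.

    The evolution variational inequality for E, tested with an earlier point of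
    the trajectory, shows that E decreases along w and that |w(r) - w(s)|^2 is
    bounded by a multiple of E(w(s)) - E(w(s + 1)) for s <= r <= s + 1. Since E
    is bounded below near a cluster point w_star, the trajectory stays near w_star on
    unit time intervals, and there the evolution variational inequality,
    tested with an arbitrary v, gives lam w_star in dJ(w_star). The monotonicity of E
    uses only the lower semicontinuity of J, not a chain rule for J(w(.)).

    For p > 2 the rate of decay of a is t^(-1/(p-2)) whatever lam is. Rescaling
    instead with a parameter mu so large that E = -1 at some positive time s
    with u(s) <> 0, one gets E <= -1 afterwards, which bounds the rescaled
    solution, and hence w, away from 0. *)
Require Import Defs.
From HB Require Import structures.
From mathcomp Require Import all_boot all_order all_algebra.
From mathcomp Require Import all_classical all_reals all_analysis.
From mathcomp Require Import ring lra.
Set Implicit Arguments. Unset Strict Implicit. Unset Printing Implicit Defensive.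
Import Order.TTheory GRing.Theory Num.Theory.
Import numFieldNormedType.Exports.
Local Open Scope classical_set_scope.
Local Open Scope ring_scope.

(** * Real induction and the calculus of right derivatives *)

Definition rderiv {R : realType} {V : normedModType R} (f : R -> V) (t : R)
    (l : V) : Prop :=
  (fun h : R => h^-1 *: (f (t + h) - f t)) @ 0^'+ --> l.

(** The supremum of the points of [a, b] satisfying [P] satisfies [P] by the limit clause, and the
    step clause forbids it to lie below [b]. *)
Lemma real_induction (R : realType) (P : R -> Prop) (a b : R) :
  a <= b -> P a ->
  (forall t, a <= t -> t < b -> P t -> exists2 r, t < r <= b & P r) ->
  (forall t, a <= t -> t <= b ->
    (forall e, 0 < e -> exists s, [/\ a <= s, s <= t, t - e < s & P s]) -> P t) ->
  P b.
Proof.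
move=> ab Pa step lim; pose S := [set t | [/\ a <= t, t <= b & P t]].
have Sa : S a by split.
have hS : has_sup S by split; [exists a | exists b => t []].
have aS : a <= sup S by exact: sup_upper_bound.
have Sb : sup S <= b by apply: ge_sup; [exists a | move=> t []].
have PS : P (sup S).
  apply: lim => // e e0; have [s Ss es] := sup_adherent e0 hS.
  exists s; case: (Ss) => as_ sb Ps; split => //; exact: sup_upper_bound.
have [Sltb|bS] := ltP (sup S) b; last first.
  by have -> : b = sup S by apply/le_anti; rewrite Sb bS.
have [r /andP[Sr rb] Pr] := step _ aS Sltb PS.
have : r <= sup S by apply: sup_upper_bound => //; split => //; lra.
by rewrite leNgt Sr.
Qed.

Section right_derivative.
Context {R : realType}.
Implicit Types V : normedModType R.

Lemma rderiv_cvg V (f : R -> V) t l :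
  rderiv f t l -> f (t + h) @[h --> 0^'+] --> f t.
Proof.
move=> fl.
have h0 : ((fun h : R => h) @ 0^'+ --> (0 : R)).
  by apply: cvg_within.
rewrite -[X in _ --> X]add0r -[X in _ --> X + _](scale0r l).
apply: (cvg_trans _ (cvgD (cvgZ h0 fl) (cvg_cst (f t)))); apply: near_eq_cvg.
near=> h; rewrite /= fctE scalerA divff ?scale1r ?subrK//.
Unshelve. all: by end_near. Qed.

Lemma rderivD V (f g : R -> V) t k l :
  rderiv f t k -> rderiv g t l -> rderiv (fun r => f r + g r) t (k + l).
Proof.
move=> fk gl; apply: (cvg_trans _ (cvgD fk gl)); apply: near_eq_cvg.
by apply: nearW => h /=; rewrite fctE -scalerDr opprD addrACA.
Qed.

Lemma rderivZ V (s : R -> R) (f : R -> V) t k l :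
  rderiv s t k -> rderiv f t l ->
  rderiv (fun r => s r *: f r) t (s t *: l + k *: f t).
Proof.
move=> sk fl.
apply: (cvg_trans _ (cvgD (cvgZ (rderiv_cvg sk) fl) (cvgZ sk (cvg_cst (f t))))).
apply: near_eq_cvg; apply: nearW => h /=.
rewrite fctE scalerA [_ * h^-1]mulrC -!scalerA -scalerDr; congr (_ *: _).
by rewrite [X in _ + X]scalerBl scalerBr addrA subrK.
Qed.

Lemma is_derive_rderiv (f : R -> R) (t d : R) : is_derive t (1 : R) f d -> rderiv f t d.
Proof.
move=> [df <-]; 
apply: (cvg_trans _ (cvg_dnbhs_at_right df)); apply: near_eq_cvg.
by apply: nearW => h /=; rewrite -[h%:A]/(h * 1) mulr1 [h + _]addrC.
Qed.

Lemma is_derive_cvg (f : R -> R) (t d : R) :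
  is_derive t (1 : R) f d -> f r @[r --> t] --> f t.
Proof.
by move=> [df _]; apply: differentiable_continuous; apply/derivable1_diffP.
Qed.

(** Strict monotonicity of [th] keeps the increments [th (t + h) - th t] positive, so they tend to 0
    from the right and the one-sided quotient of [u] applies. *)
Lemma rderiv_comp V (u : R -> V) (th : R -> R) t k l :
  {homo th : x y / x < y} -> rderiv th t k -> rderiv u (th t) l ->
  rderiv (u \o th) t (k *: l).
Proof.
move=> thi thk ul.
have c0 : th (t + h) - th t @[h --> 0^'+] --> 0^'+.
  move=> A A0.
  have H : th (t + h) - th t @[h --> 0^'+] --> (0 : R).
    rewrite -[X in _ --> X](subrr (th t)).
    by apply: cvgB; [exact: rderiv_cvg thk|exact: cvg_cst].
  have {}H : \forall h \near 0^'+, 0 < th (t + h) - th t -> A (th (t + h) - th t).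
    exact: (H _ A0).
  have : \forall h \near 0^'+, A (th (t + h) - th t).
    apply: filterS2 H (nbhs_right_gt 0) => h hA h0.
    by apply: hA; rewrite subr_gt0; apply: thi; rewrite ltrDl.
  by [].
apply: (cvg_trans _ (cvgZ thk (cvg_comp _ _ c0 ul))).
apply: near_eq_cvg; near=> h => /=.
have hp : 0 < h by near: h; exact: nbhs_right_gt.
have tp : 0 < th (t + h) - th t by rewrite subr_gt0; apply: thi; rewrite ltrDl.
rewrite [th t + _]addrC subrK scalerA; congr (_ *: _).
by apply: (@mulfK R); rewrite gt_eqF.
Unshelve. all: by end_near. Qed.

(** With only a right derivative at hand, real induction takes the place of the mean value theorem:
    the graph of [F] stays below every line of small positive slope [d] through its left end
    point. *)
Lemma rderiv_le0_nonincr (F l : R -> R) a b : a <= b ->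
  (forall t, a <= t <= b -> F r @[r --> t] --> F t) ->
  (forall t, a <= t <= b -> rderiv F t (l t) /\ l t <= 0) ->
  F b <= F a.
Proof.
move=> ab Fc Fd; apply/ler_addgt0Pr => e e0.
(* This gives [d * (b - a) <= e]; the [+ 1] covers [a = b]. *)
pose d := e / (b - a + 1).
have d0 : 0 < d by apply: divr_gt0 => //; lra.
suff : F b <= F a + d * (b - a).
  move=> /le_trans; apply; rewrite lerD2l /d mulrAC ler_pdivrMr; last lra.
  by rewrite ler_pM2l//; lra.
apply: (@real_induction R (fun t => F t <= F a + d * (t - a)) a b) => //.
- by rewrite subrr mulr0 addr0.
- move=> t at_ tb Pt; have [|Ft lt] := Fd t; first by rewrite at_ ltW.
  have H : \forall h \near 0^'+, h^-1 * (F (t + h) - F t) < d.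
    by apply: (cvgr_lt _ Ft); lra.
  have [h [h0 hb Hh]] : exists h, [/\ 0 < h, h < b - t &
      h^-1 * (F (t + h) - F t) < d].
    near (0:R)^'+ => h; exists h; split; near: h.
    - exact: nbhs_right_gt.
    - by apply: nbhs_right_lt; lra.
    - exact: H.
  exists (t + h); first lra.
  rewrite mulrC ltr_pdivrMr // in Hh; lra.
- move=> t at_ tb Hs; rewrite leNgt; apply/negP => Flt.
  have ct : F r - d * (r - a) @[r --> t] --> F t - d * (t - a).
    apply: cvgB; first by apply: Fc; rewrite at_ tb.
    apply: cvgM; first exact: cvg_cst.
    by apply: cvgB; [exact: cvg_id|exact: cvg_cst].
  have /nbhs_ballP[/= e1 e10 He] : \forall r \near t, F a < F r - d * (r - a).
    by apply: (cvgr_gt _ ct); lra.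
  have [s [as_ st ts Ps]] := Hs _ e10.
  have : F a < F s - d * (s - a).
    by apply: He; rewrite /ball /= ger0_norm; lra.
  lra.
Unshelve. all: by end_near. Qed.

End right_derivative.

(** * Inner product algebra, continuity, and the right derivative of a squared distance *)

Section inner_product_theory.
Context {R : realType} {H : normedModType R} {ip : H -> H -> R}.
Hypothesis hip : inner_product ip.

Lemma ipC x y : ip x y = ip y x. Proof. exact: hip.1. Qed.

Lemma ipxx x : ip x x = `|x| ^+ 2. Proof. exact: hip.2.2. Qed.

Lemma ip_addl x y z : ip (x + y) z = ip x z + ip y z.
Proof. by have := hip.2.1 1 x y z; rewrite scale1r mul1r. Qed.

Lemma ip_zerol z : ip 0 z = 0.
Proof. by have := ip_addl 0 0 z; rewrite addr0; lra. Qed.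

Lemma ip_scalel c x z : ip (c *: x) z = c * ip x z.
Proof. by have := hip.2.1 c x 0 z; rewrite addr0 ip_zerol addr0. Qed.

Lemma ip_oppl x z : ip (- x) z = - ip x z.
Proof. by rewrite -scaleN1r ip_scalel mulN1r. Qed.

Lemma ip_addr x y z : ip z (x + y) = ip z x + ip z y.
Proof. by rewrite ipC ip_addl !(ipC z). Qed.

Lemma ip_scaler c x z : ip z (c *: x) = c * ip z x.
Proof. by rewrite ipC ip_scalel (ipC z). Qed.

Lemma ip_oppr x z : ip z (- x) = - ip z x.
Proof. by rewrite ipC ip_oppl (ipC z). Qed.

Lemma ip_polar x y : ip x y = (`|x + y| ^+ 2 - `|x| ^+ 2 - `|y| ^+ 2) / 2.
Proof. by rewrite -!ipxx ip_addl !ip_addr (ipC y x); field. Qed.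

(** Polarization reduces this to the continuity of the norm. *)
Lemma cvg_ip (T : Type) (F : set_system T) {FF : Filter F} (f g : T -> H) k l :
  f @ F --> k -> g @ F --> l -> (fun x => ip (f x) (g x)) @ F --> ip k l.
Proof.
move=> fk gl; rewrite ip_polar; under eq_fun do rewrite ip_polar.
apply: cvgM; last exact: cvg_cst.
have sq (h : T -> H) m : h @ F --> m -> `|h x| ^+ 2 @[x --> F] --> `|m| ^+ 2.
  by move=> hm; apply: cvgM; apply: cvg_norm.
by apply: cvgB; [apply: cvgB|]; apply: sq => //; exact: cvgD.
Qed.

Lemma rderiv_normsq (W : R -> H) v t l : rderiv W t l ->
  rderiv (fun r => `|W r - v| ^+ 2) t (2 * ip l (W t - v)).
Proof.
move=> Wl.
(* The quotient of the squared distance is the inner product of the quotient of [W] with this second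
   factor. *)
have c2 : (fun h => 2 *: (W t - v) + (W (t + h) - W t)) @ 0^'+ --> 2 *: (W t - v).
  rewrite -[X in _ --> X]addr0 -[X in _ --> _ + X](subrr (W t)).
  apply: cvgD; first exact: cvg_cst.
  by apply: cvgB; [exact: rderiv_cvg Wl|exact: cvg_cst].
rewrite -ip_scaler; apply: (cvg_trans _ (cvg_ip Wl c2)).
apply: near_eq_cvg; apply: nearW => h /=.
rewrite ip_scalel; congr (_ * _).
have -> : W (t + h) - v = (W (t + h) - W t) + (W t - v) by rewrite addrA subrK.
move: (W (t + h) - W t) (W t - v) => x y.
by rewrite -!ipxx ip_addl !ip_addr !ip_scaler (ipC y x); ring.
Qed.

End inner_product_theory.

(** * The flow of [J] minus a multiple of the squared norm: energy decay and cluster points *)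

Section rescaled_flow.
Context {R : realType} {H : normedModType R} {ip : H -> H -> R}.
Context {J : H -> \bar R} {W z : R -> H} {j : R -> R} {mu a : R}.
Hypothesis hip : inner_product ip.
Hypothesis Jlsc : lower_semicontinuous J.
Hypothesis mu0 : 0 <= mu.
Hypothesis Wc : forall t, a <= t -> W r @[r --> t] --> W t.
Hypothesis Wd : forall t, a <= t -> rderiv W t (mu *: W t - z t).
Hypothesis Wz : forall t, a <= t -> subdiff ip J (W t) (z t).
Hypothesis Wj : forall t, a <= t -> J (W t) = (j t)%:E.

Let energy t := j t - mu / 2 * `|W t| ^+ 2.

Lemma evi t v c : a <= t -> J v = c%:E ->
  ip (mu *: W t - z t) (W t - v) <= mu * ip (W t) (W t - v) + c - j t.
Proof.
move=> at_ Jv; have := Wz at_ v; rewrite Wj// Jv -EFinD lee_fin.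
rewrite (ip_addl hip) (ip_oppl hip) (ip_scalel hip) -(opprB (W t) v) (ip_oppr hip).
lra.
Qed.

(** The identity 2 <x, x - y> = |x - y|^2 + |x|^2 - |y|^2 turns the difference of [j] in [evi] into
    a difference of energies. *)
Lemma evi_energy t s : a <= t -> a <= s ->
  2 * ip (mu *: W t - z t) (W t - W s) <=
  mu * `|W t - W s| ^+ 2 + 2 * (energy s - energy t).
Proof.
move=> at_ as_; have := evi at_ (Wj as_); rewrite /energy -!(ipxx hip).
rewrite !(ip_addr hip, ip_addl hip, ip_oppl hip, ip_oppr hip, ip_scalel hip).
rewrite (ipC hip (W s) (W t)); lra.
Qed.

Let is_derive_exp_damp s t :
  is_derive t (1 : R) (fun r => expR (- (mu * (r - s)))) (- mu * expR (- (mu * (t - s)))).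
Proof.
rewrite mulrC.
apply: (@is_derive1_comp _ expR (fun r => - (mu * (r - s)))).
by apply: is_derive_eq; rewrite /GRing.scale/=; ring.
Qed.

(* exp(-mu (r - s)) |W r - W s|^2 - c (r - s): the exponential absorbs the term
   mu |W r - W s|^2 of the evolution variational inequality. *)
Lemma damped_dist_le s b c : a <= s -> s <= b ->
  (forall t, s <= t <= b ->
    2 * expR (- (mu * (t - s))) * (energy s - energy t) <= c) ->
  expR (- (mu * (b - s))) * `|W b - W s| ^+ 2 <= c * (b - s).
Proof.
move=> as_ sb Hc.
pose g r := expR (- (mu * (r - s))).
pose F r := g r * `|W r - W s| ^+ 2 + (- c) * (r - s).
have dlin t : is_derive t (1 : R) (fun r => (- c) * (r - s)) (- c).
  by apply: is_derive_eq; rewrite /GRing.scale/=; ring.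
pose l t := g t *: (2 * ip (mu *: W t - z t) (W t - W s)) +
  (- mu * g t) *: `|W t - W s| ^+ 2 + (- c).
suff : F b <= F s.
  by rewrite /F !subrr normr0 expr0n/= !mulr0 /g => H1; lra.
apply: (@rderiv_le0_nonincr _ F l s b) => // t /andP[st tb].
- have at_ : a <= t by exact: le_trans st.
  have Ws : W r - W s @[r --> t] --> W t - W s.
    by apply: cvgB; [exact: Wc|exact: cvg_cst].
  have sq : `|W r - W s| ^+ 2 @[r --> t] --> `|W t - W s| ^+ 2.
    by apply: cvgM; apply: cvg_norm.
  exact: cvgD (cvgM (is_derive_cvg (is_derive_exp_damp s t)) sq)
    (is_derive_cvg (dlin t)).
- have at_ : a <= t by exact: le_trans st.
  split.
    exact: rderivD (rderivZ (is_derive_rderiv (is_derive_exp_damp s t))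
      (rderiv_normsq hip (v := W s) (Wd at_))) (is_derive_rderiv (dlin t)).
  have := Hc t; rewrite st tb -/(g t) => /(_ isT).
  have := evi_energy at_ as_; rewrite -(ler_pM2l (expR_gt0 (- (mu * (t - s))))).
  rewrite /l /GRing.scale/= -/(g t); lra.
Qed.

(** If the energy were above [energy s] on all of (s, b], [damped_dist_le] with [c = 0] would give
    [W b = W s], hence equal energies at [s] and [b]. *)
Lemma energy_step s b : a <= s -> s < b ->
  exists2 r, s < r <= b & energy r <= energy s.
Proof.
move=> as_ sb; apply: contrapT => nex.
have gt r : s < r <= b -> energy s < energy r.
  by move=> sr; rewrite ltNge; apply/negP => le; apply: nex; exists r.
have : expR (- (mu * (b - s))) * `|W b - W s| ^+ 2 <= 0 * (b - s).
  apply: damped_dist_le => //; first exact: ltW.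
  move=> t; rewrite le_eqVlt => /andP[/orP[/eqP <- _|st tb]].
    by rewrite !subrr !mulr0.
  rewrite pmulr_rle0; last by rewrite mulr_gt0// expR_gt0.
  by rewrite subr_le0; apply/ltW/gt; rewrite st.
rewrite mul0r pmulr_rle0 ?expR_gt0// => Wbs.
have : `|W b - W s| ^+ 2 == 0 by rewrite eq_le Wbs sqr_ge0.
rewrite expf_eq0/= normr_eq0 subr_eq0 => /eqP Weq.
have ab : a <= b by lra.
have := gt b; rewrite sb lexx => /(_ isT); rewrite /energy Weq.
by have := Wj ab; rewrite Weq (Wj as_) => -[->]; rewrite ltxx.
Qed.

Lemma energy_lsc t c : a <= t -> c < energy t ->
  exists2 e, 0 < e & forall s, a <= s -> `|t - s| < e -> c < energy s.
Proof.
move=> at_ ct; pose d := (energy t - c) / 2.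
have d0 : 0 < d by rewrite /d; lra.
have [|V Vt VJ] := Jlsc (x := W t) (a := j t - d).
  by rewrite Wj// lte_fin; lra.
have nV : \forall r \near t, V (W r) by exact: (Wc at_).
have nsq : \forall r \near t, mu / 2 * `|W r| ^+ 2 < mu / 2 * `|W t| ^+ 2 + d.
  have csq : mu / 2 * `|W r| ^+ 2 @[r --> t] --> mu / 2 * `|W t| ^+ 2.
    by apply: cvgM; [exact: cvg_cst|apply: cvgM; apply: cvg_norm; exact: Wc].
  by apply: (cvgr_lt _ csq); lra.
have /nbhs_ballP[/= e e0 He] : \forall r \near t,
    V (W r) /\ mu / 2 * `|W r| ^+ 2 < mu / 2 * `|W t| ^+ 2 + d.
  exact: filterI.
exists e => // s as_ ts; have [Vs sqs] := He _ ts.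
have := VJ _ Vs; rewrite Wj// lte_fin /energy.
by have : energy t = c + 2 * d; [rewrite /d; lra|rewrite /energy; lra].
Qed.

(** Real induction: [energy_step] moves forward, and lower semicontinuity carries the bound to
    limits from the left. *)
Lemma energy_nonincr s b : a <= s -> s <= b -> energy b <= energy s.
Proof.
move=> as_ sb.
apply: (@real_induction _ (fun t => energy t <= energy s) s b) => //.
- move=> t st tb Pt; have [r rt Pr] := energy_step (le_trans as_ st) tb.
  by exists r => //; exact: le_trans Pt.
- move=> t st tb Hs; rewrite leNgt; apply/negP => lt.
  have [e e0 He] := energy_lsc (le_trans as_ st) lt.
  have [r [sr rt ter Pr]] := Hs e e0.
  have : energy s < energy r.
    by apply: He; [exact: le_trans sr|rewrite ger0_norm; lra].
  by rewrite ltNge Pr.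
Qed.

(** On [s, s + 1] every energy drop is at most the total drop [D], and the damping factor is at
    least [expR (- mu)]. *)
Lemma osc_le s r : a <= s -> s <= r -> r <= s + 1 ->
  `|W r - W s| ^+ 2 <= 2 * expR mu * (energy s - energy (s + 1)).
Proof.
move=> as_ sr rs.
pose D := energy s - energy (s + 1).
have D0 : 0 <= D by rewrite subr_ge0; apply: energy_nonincr => //; lra.
have H1 : expR (- (mu * (r - s))) * `|W r - W s| ^+ 2 <= 2 * D * (r - s).
  apply: damped_dist_le => // t /andP[st tr].
  have e1 : expR (- (mu * (t - s))) <= 1.
    by rewrite -expR0 ler_expR oppr_le0 mulr_ge0//; lra.
  have h1 : energy t <= energy s by apply: energy_nonincr.
  have h2 : energy (s + 1) <= energy t by apply: energy_nonincr; lra.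
  rewrite -mulrA ler_pM2l//; apply: (@le_trans _ _ (energy s - energy t)).
    by rewrite ler_piMl// subr_ge0.
  by rewrite /D; lra.
have e2 : expR (- mu) <= expR (- (mu * (r - s))).
  by rewrite ler_expR lerN2 ler_piMr//; lra.
have H2 : expR (- mu) * `|W r - W s| ^+ 2 <= 2 * D.
  apply: le_trans (_ : _ <= 2 * D * (r - s)) _; last first.
    by rewrite ler_piMr ?mulr_ge0//; lra.
  apply: le_trans H1; rewrite ler_wpM2r// sqr_ge0.
rewrite -(ler_pM2l (expR_gt0 (- mu))); apply: (le_trans H2).
rewrite -/D [_ * expR mu]mulrC !mulrA -expRD addNr expR0; lra.
Qed.

Lemma cluster_subdiff w : (forall v, 0 <= J v)%E ->
  (forall T e : R, 0 < e -> exists t, [/\ a <= t, T <= t & `|W t - w| < e]) ->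
  subdiff ip J w (mu *: w).
Proof.
move=> J0 clu v; rewrite leNgt; apply/negP.
have j0 t : a <= t -> 0 <= j t by move=> /Wj E; rewrite -lee_fin -E.
case Jv : (J v) => [c| |]; last 2 first.
- by rewrite ltNge leey.
- by have := J0 v; rewrite Jv.
move=> lt0.
(* The subgradient inequality fails at [v] exactly when [m < J w]; by lower semicontinuity [J] then
   exceeds [m + d] near [w]. *)
pose m := c - ip (mu *: w) (v - w).
have mE : m = c + mu * ip w (w - v).
  by rewrite /m (ip_scalel hip) -(opprB w v) (ip_oppr hip); ring.
have [d d0 md] : exists2 d, 0 < d & ((m + d)%:E < J w)%E.
  have : (m%:E < J w)%E by move: lt0; rewrite /m EFinB lteBlDr.
  case: (J w) => [r| |] //; last by exists 1; rewrite ?ltry.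
  by rewrite lte_fin => mr; exists ((r - m) / 2); rewrite ?lte_fin; lra.
have [V Vw VJ] := Jlsc md.
have near_m : \forall y \near w, mu * ip y (y - v) + c < m + d / 2.
  have cm : mu * ip y (y - v) + c @[y --> w] --> mu * ip w (w - v) + c.
    apply: cvgD; last exact: cvg_cst.
    apply: cvgM; [exact: cvg_cst|apply: (cvg_ip hip); first exact: cvg_id].
    by apply: cvgB; [exact: cvg_id|exact: cvg_cst].
  apply: (cvgr_lt _ cm).
  by rewrite mE; lra.
have csq : `|y - v| ^+ 2 @[y --> w] --> `|w - v| ^+ 2.
  by apply: cvgM; apply: cvg_norm; apply: cvgB; [exact: cvg_id|exact: cvg_cst
    |exact: cvg_id|exact: cvg_cst].
have near_l : \forall y \near w, `|y - v| ^+ 2 < `|w - v| ^+ 2 + d / 2.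
  by apply: (cvgr_lt _ csq); lra.
have near_g : \forall y \near w, `|w - v| ^+ 2 - d / 2 < `|y - v| ^+ 2.
  by apply: (cvgr_gt _ csq); lra.
have /nbhs_ballP[/= e e0 He] : \forall y \near w, [/\ V y,
    mu * ip y (y - v) + c < m + d / 2, `|y - v| ^+ 2 < `|w - v| ^+ 2 + d / 2 &
    `|w - v| ^+ 2 - d / 2 < `|y - v| ^+ 2].
  by near=> y; split; near: y.
(* The trajectory returns near [w] at some later time, where [J >= 0] bounds the energy below;
   monotonicity carries the bound back to [t]. *)
have lbE t : a <= t -> - (mu / 2 * (`|w| + 1) ^+ 2) <= energy t.
  move=> at_; have [s [as_ ts /ltW Wsw]] := clu t 1 ltr01.
  apply: (le_trans _ (energy_nonincr at_ ts)); rewrite /energy.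
  have Ws : `|W s| <= `|w| + 1.
    by rewrite -(subrK w (W s)) addrC; apply: le_trans (ler_normD _ _) _; lra.
  have : mu / 2 * `|W s| ^+ 2 <= mu / 2 * (`|w| + 1) ^+ 2.
    by rewrite ler_wpM2l ?divr_ge0// lerXn2r ?nnegrE.
  have := j0 s as_; lra.
pose S := [set energy t | t in [set t | a <= t]].
have hS : has_inf S.
  split; first by exists (energy a); exists a => /=.
  by exists (- (mu / 2 * (`|w| + 1) ^+ 2)) => _ [t at_ <-]; exact: lbE.
(* An energy drop below [del] over a unit interval keeps the oscillation in [osc_le] below [e / 2].
   Past [T] the energy is within [del] of its infimum, so every later drop is that small. *)
pose del := (e / 2) ^+ 2 / (2 * expR mu).
have ex0 : 0 < 2 * expR mu by rewrite mulr_gt0// expR_gt0.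
have del0 : 0 < del by rewrite divr_gt0// exprn_gt0// divr_gt0.
have [_ [T aT <-] ET] := inf_adherent del0 hS.
have e20 : 0 < e / 2 by rewrite divr_gt0.
have [s [as_ Ts Wsw]] := clu T (e / 2) e20.
have osc r : s <= r -> r <= s + 1 -> `|W r - W s| < e / 2.
  move=> sr rs; rewrite -(@ltr_pXn2r _ 2) ?nnegrE// ?ltW//.
  apply: le_lt_trans (osc_le as_ sr rs) _.
  rewrite mulrC -ltr_pdivlMr//.
  have : inf S <= energy (s + 1).
    by apply: inf_lbound; [exact: hS.2|exists (s + 1) => //=; lra].
  have := energy_nonincr aT Ts; rewrite -/del; lra.
have inball r : s <= r -> r <= s + 1 -> ball w e (W r).
  move=> sr rs; rewrite -ball_normE /ball_/= distrC.
  rewrite -(subrKA (W s)); apply: le_lt_trans (ler_normD _ _) _.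
  have := osc r sr rs; lra.
(* While [W] stays in the ball, [evi] makes the squared distance to [v] decrease at rate at least
   [d]. Over unit time it loses [d], yet its two end values lie strictly within [d / 2] of
   [|w - v|^2]. *)
pose F r := `|W r - v| ^+ 2 + d * (r - s).
have dlin t : is_derive t (1 : R) (fun r => d * (r - s)) d.
  by apply: is_derive_eq; rewrite /GRing.scale/=; ring.
suff : F (s + 1) <= F s.
  have [||_ _ _] := He (W (s + 1)) (inball _ _ _); [lra|lra|].
  have [||_ _ + _] := He (W s) (inball _ _ _); [lra|lra|].
  rewrite /F; lra.
pose l t := 2 * ip (mu *: W t - z t) (W t - v) + d.
apply: (@rderiv_le0_nonincr _ F l) => [|t /andP[st ts]|t /andP[st ts]].
- lra.
- have at_ : a <= t by exact: le_trans st.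
  have Wv : W r - v @[r --> t] --> W t - v.
    by apply: cvgB; [exact: Wc|exact: cvg_cst].
  have sq : `|W r - v| ^+ 2 @[r --> t] --> `|W t - v| ^+ 2.
    by apply: cvgM; apply: cvg_norm.
  exact: cvgD sq (is_derive_cvg (dlin t)).
- have at_ : a <= t by exact: le_trans st.
  split.
    exact: rderivD (rderiv_normsq hip (v := v) (Wd at_))
      (is_derive_rderiv (dlin t)).
  have [Vt mt _ _] := He _ (inball t st ts).
  have := VJ _ Vt; rewrite Wj// lte_fin.
  have := evi at_ Jv; rewrite /l; lra.
Unshelve. all: by end_near. Qed.

End rescaled_flow.

(** * Consequences of convexity and homogeneity of [J] *)

Section homogeneous_functional.
Context {R : realType} {H : normedModType R} {ip : H -> H -> R}.
Context {J : H -> \bar R} {p : R}.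
Hypothesis hip : inner_product ip.
Hypothesis Jp : proper_ext J.
Hypothesis Jh : abs_p_homogeneous p J.

(** Homogeneity makes [J] even, and convexity at the midpoint of [v] and [- v] gives
    [J 0 <= J v]. *)
Lemma homogeneous_convex_ge0 : convex_ext J -> forall v, (0 <= J v)%E.
Proof.
move=> Jc v; have Jn : J (- v) = J v.
  by rewrite -scaleN1r Jh.1 ?oppr_eq0 ?oner_eq0// normrN normr1 powR1 mul1e.
have h : 0 < (2^-1 : R) < 1 by apply/andP; split; lra.
have := Jc v (- v) _ h.
have -> : 1 - 2^-1 = 2^-1 :> R by field.
rewrite -scalerDr subrr scaler0 Jh.2 Jn.
have := Jp.1 v; case: (J v) => [r| |] // _.
rewrite -!EFinM -EFinD !lee_fin; lra.
Qed.

Lemma subdiff_fin_num v zeta : subdiff ip J v zeta -> J v \is a fin_num.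
Proof.
move=> vz; have [x Jx] := Jp.2; have := Jp.1 v.
by have := vz x; case: (J v) => [r| |] //; rewrite addye// leye_eq; case: (J x) Jx.
Qed.

(** With the test point written as [c *: y], all terms of the subgradient inequality carry the
    factor c^p. *)
Lemma subdiff_homogeneous c v zeta : 0 < c -> subdiff ip J v zeta ->
  subdiff ip J (c *: v) (powR c (p - 1) *: zeta).
Proof.
move=> c0 vz x; have Jf := subdiff_fin_num vz.
have cn0 : c != 0 by rewrite gt_eqF.
have -> : x = c *: (c^-1 *: x) by rewrite scalerA divff// scale1r.
move: (c^-1 *: x) => y; rewrite !Jh.1// gtr0_norm//.
have cp : c * c `^ (p - 1) = c `^ p.
  by rewrite -[X in X * _]powRr1 ?ltW// -powRD ?cn0 ?implybT// addrC subrK.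
rewrite -scalerBr (ip_scalel hip) (ip_scaler hip) mulrA [_ `^ _ * c]mulrC cp.
rewrite EFinM -muleDr//; last by rewrite fin_num_adde_defl.
by rewrite lee_pmul2l// ?lte_fin ?powR_gt0//; exact: vz.
Qed.

End homogeneous_functional.

(* Under t = theta ((p - 2) lam) tau, both branches of a_fun become
   exp(-lam tau). *)
Definition theta {R : realType} (q t : R) : R :=
  if q == 0 then t else (expR (q * t) - 1) / q.

(** * The time change and the decay of [a_fun] *)

Section time_change.
Context {R : realType}.
Implicit Types (p q lam mu t : R).

Lemma theta0 q : theta q 0 = 0.
Proof. by rewrite /theta mulr0 expR0 subrr mul0r; case: ifP. Qed.

Lemma is_derive_theta q (t : R) : is_derive t (1 : R) (theta q) (expR (q * t)).
Proof.
rewrite /theta; have [->|q0] := eqVneq q 0.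
  by rewrite mul0r expR0; apply: is_derive_id.
have dq : is_derive t (1 : R) (fun r => q * r) q.
  by apply: is_derive_eq; rewrite /GRing.scale/=; ring.
have de := is_derive1_comp (is_derive_expR (q * t)) dq.
have -> : expR (q * t) = q^-1 *: (expR (q * t) * q - 0).
  by rewrite subr0 /GRing.scale/= mulrCA mulVf// mulr1.
have -> : (fun r => (expR (q * r) - 1) / q) =
    q^-1 \*: ((expR \o (fun r => q * r)) - cst 1).
  by apply/funext => r /=; rewrite mulrC.
apply: is_deriveZ; apply: is_deriveB.
Qed.

Lemma theta_mono q : 0 <= q -> {mono theta q : x y / x < y}.
Proof.
move=> q0 x y; rewrite /theta; have [//|qn0] := eqVneq q 0.
have qp : 0 < q by rewrite lt_neqAle eq_sym qn0.
by rewrite ltr_pM2r ?invr_gt0// ltrD2r ltr_expR ltr_pM2l.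
Qed.

(** Turns late times of the original flow into late times of the rescaled one. *)
Lemma theta_surj q T t : 0 <= q -> 0 <= T -> theta q T <= t ->
  exists2 s, T <= s & theta q s = t.
Proof.
move=> q0 T0; rewrite /theta; have [_ Tt|qn0] := eqVneq q 0; first by exists t.
have qp : 0 < q by rewrite lt_neqAle eq_sym qn0.
rewrite ler_pdivrMr// => Tt.
have e1 : expR (q * T) <= 1 + q * t by lra.
have pos : 0 < 1 + q * t by apply: lt_le_trans e1; exact: expR_gt0.
exists (ln (1 + q * t) / q).
  by rewrite ler_pdivlMr// mulrC -ler_expR lnK// posrE.
by rewrite [q * _]mulrC divfK// lnK ?posrE//; field.
Qed.

Lemma a_fun_theta p lam t : 2 <= p -> 0 < lam ->
  a_fun p lam (theta ((p - 2) * lam) t) = expR (- (lam * t)).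
Proof.
move=> p2 l0; rewrite /a_fun /theta; case: ifP => [p2'|/negbT].
  have p0 : 0 < p - 2 by lra.
  have q0 : (p - 2) * lam != 0 by rewrite mulf_neq0 ?gt_eqF.
  rewrite (negbTE q0) [_ * (_ / _)]mulrC divfK// addrC subrK -expRM; congr expR.
  by field; rewrite gt_eqF.
rewrite -leNgt => p2'; have -> : p = 2 by apply/le_anti; rewrite p2 p2'.
by rewrite subrr mul0r eqxx.
Qed.

Lemma a_fun_gt0 p lam t : 2 <= p -> 0 < lam -> 0 <= t -> 0 < a_fun p lam t.
Proof.
move=> p2 l0 t0; rewrite /a_fun; case: ifP => _; last exact: expR_gt0.
by rewrite powR_gt0// ltr_wpDr// mulr_ge0// mulr_ge0 ?(ltW l0)//; lra.
Qed.

(* For p > 2 the decay rate of a_fun does not depend on lam; for p = 2 it does,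
   and the statement fails. *)
Lemma a_fun_comparable p lam mu s : 2 < p -> 0 < lam -> 0 < mu -> 0 <= s ->
  exists2 K, 0 < K &
    forall t, s <= t -> a_fun p lam t <= K * a_fun p mu (t - s).
Proof.
move=> p2 l0 m0 s0; pose r := (p - 2)^-1.
have p0 : 0 < p - 2 by lra.
have r0 : 0 < r by rewrite invr_gt0.
(* Both [k <= 1] and [k * mu <= lam] hold, so [k] times the base of [a_fun p mu (t - s)] is at most
   the base of [a_fun p lam t]. *)
pose k := Num.min 1 (lam / mu).
have k0 : 0 < k by rewrite lt_min ltr01 divr_gt0.
exists (k `^ r)^-1; first by rewrite invr_gt0 powR_gt0.
move=> t st; rewrite /a_fun p2 !powRN -invfM -/r.
have b0 : 0 < 1 + (p - 2) * mu * (t - s).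
  have ts : 0 <= t - s by rewrite subr_ge0.
  by rewrite ltr_wpDr// mulr_ge0// mulr_ge0// ltW.
rewrite -powRM ?(ltW k0) ?(ltW b0)//.
have km : k * mu <= lam.
  by rewrite -ler_pdivlMr// ge_min lexx orbT.
have k1 : k <= 1 by rewrite ge_min lexx.
have kb : k * (1 + (p - 2) * mu * (t - s)) <= 1 + (p - 2) * lam * t.
  rewrite mulrDr mulr1 lerD//.
  rewrite mulrA mulrCA -!mulrA ler_pM2l// mulrA.
  by apply: ler_pM => //; [rewrite mulr_ge0 ?ltW|lra|lra].
have kb0 : 0 < k * (1 + (p - 2) * mu * (t - s)) by rewrite mulr_gt0.
have b1 := lt_le_trans kb0 kb.
rewrite lef_pV2 ?posrE ?powR_gt0//.
by apply: ge0_ler_powR => //; [exact: ltW r0|exact: ltW kb0|exact: ltW b1].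
Qed.

End time_change.

(** * The gradient flow in rescaled time and amplitude *)

Section rescaling.
Context {R : realType} {H : normedModType R} {ip : H -> H -> R}.
Context {J : H -> \bar R} {p : R} {f : H} {u : R -> H}.
Hypothesis hip : inner_product ip.
Hypothesis Jp : proper_ext J.
Hypothesis Jh : abs_p_homogeneous p J.
Hypothesis p2 : 2 <= p.
Hypothesis hu : gradient_flow ip J f u.

Lemma gradient_flow_cvg (t : R) : 0 < t -> u r @[r --> t] --> u t.
Proof.
move=> t0; have /subspace_continuousP /(_ t (ltW t0)) := hu.1.
rewrite within_interior//.
rewrite /interior; near=> r => /=; apply: ltW; near: r; exact: lt_nbhsr.
Unshelve. all: by end_near. Qed.

(** Supplies a nonzero state at a positive time, where [J] is finite; [J f] itself may be
    infinite. *)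
Lemma gradient_flow_neq0 : f != 0 -> exists2 s, 0 < s & u s != 0.
Proof.
move=> f0.
have : u @ within [set t : R | 0 <= t] (nbhs 0) --> u 0.
  by have /subspace_continuousP := hu.1; apply => /=.
rewrite hu.2.2.1 => /cvg_norm cf.
have : \forall s \near within [set t : R | 0 <= t] (nbhs 0), 0 < `|u s|.
  by apply: (cvgr_gt _ cf); rewrite normr_gt0.
move=> /nbhs_ballP[/= e e0 He]; exists (e / 2); first exact: divr_gt0.
rewrite -normr_gt0; apply: He; last by rewrite /= divr_ge0// ltW.
rewrite -ball_normE /ball_/= sub0r normrN gtr0_norm ?divr_gt0//; lra.
Qed.

(** The condition [0 < s + a] keeps the original time positive, where the flow is
    right-differentiable. It is met with [s = 0], [a = 1] for the eigenvector equation and with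
    [s > 0], [a = 0] for the lower bound. *)
Lemma rescaled_flow_spec s mu a : 0 <= mu -> 0 <= s -> 0 <= a -> 0 < s + a ->
  let W t := expR (mu * t) *: u (s + theta ((p - 2) * mu) t) in
  exists z j, [/\ forall t, a <= t -> W r @[r --> t] --> W t,
    forall t, a <= t -> rderiv W t (mu *: W t - z t),
    forall t, a <= t -> subdiff ip J (W t) (z t) &
    forall t, a <= t -> J (W t) = (j t)%:E].
Proof.
move=> mu0 s0 a0 sa W; set q := (p - 2) * mu.
have q0 : 0 <= q by rewrite mulr_ge0// subr_ge0.
have pos t : a <= t -> 0 < s + theta q t.
  rewrite le_eqVlt => /orP[/eqP <-|at_]; last first.
    by rewrite ltr_wpDl// -(theta0 q) theta_mono// (le_lt_trans a0).
  move: a0; rewrite le_eqVlt => /orP[/eqP a0|a0].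
    by move: sa; rewrite -a0 theta0.
  by rewrite ltr_wpDl// -(theta0 q) theta_mono.
(* The value 0 at nonpositive times is a dummy. *)
have /choice[zeta hz] : forall t, exists zeta, 0 < t ->
    subdiff ip J (u t) zeta /\ rderiv u t (- zeta).
  move=> t; have [t0|t0] := ltP 0 t; last by exists 0.
  by have [zeta [[]]] := hu.2.2.2 t t0; exists zeta.
pose th t := s + theta q t.
have dth t : is_derive t (1 : R) th (expR (q * t)).
  rewrite -[expR _]add0r; apply: is_deriveD; exact: is_derive_theta.
have dexp (t : R) : is_derive t (1 : R) (fun r => expR (mu * r)) (mu * expR (mu * t)).
  rewrite mulrC; apply: (@is_derive1_comp _ expR (fun r => mu * r)).
  by apply: is_derive_eq; rewrite /GRing.scale/=; ring.
(* Since [mu + q = mu * (p - 1)], the factor produced by the chain rule is the one that homogeneity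
   requires of a subgradient at [W t]. *)
pose z t := (expR (mu * t) * expR (q * t)) *: zeta (th t).
have Wz t : a <= t -> subdiff ip J (W t) (z t).
  move=> at_; have [h1 _] := hz _ (pos t at_).
  have := subdiff_homogeneous hip Jp Jh (expR_gt0 (mu * t)) h1.
  rewrite -expRM /z -expRD.
  by have -> : mu * t * (p - 1) = mu * t + q * t by rewrite /q; ring.
exists z, (fun t => fine (J (W t))); split => // t at_.
- apply: cvgZ; first exact: is_derive_cvg (dexp t).
  apply: (@cvg_comp _ _ _ th u _ _ _ (is_derive_cvg (dth t))).
  exact/gradient_flow_cvg/pos.
- have [_ h2] := hz _ (pos t at_).
  have thi : {homo th : x y / x < y} by move=> x y; rewrite ltrD2l theta_mono.
  have -> : mu *: W t - z t = expR (mu * t) *: (expR (q * t) *: - zeta (th t)) +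
      (mu * expR (mu * t)) *: u (th t).
    by rewrite /W /z !scalerN !scalerA addrC.
  exact: rderivZ (is_derive_rderiv (dexp t))
    (rderiv_comp thi (is_derive_rderiv (dth t)) h2).
- by rewrite fineK//; exact: subdiff_fin_num (Wz t at_).
Qed.

End rescaling.

(** * The eigenvector equation for the limit, and its nonvanishing when p > 2 *)

Theorem theorem4 (R : realType) (H : completeNormedModType R)
  (ip : H -> H -> R) (J : H -> \bar R) (p lam1 : R) (f : H) (u : R -> H)
  (w_star : H) :
  inner_product ip ->
  convex_ext J -> lower_semicontinuous J -> proper_ext J -> dense_dom J ->
  abs_p_homogeneous p J ->
  lambda1_ext ip p J = lam1%:E -> 0 < lam1 ->
  2 <= p ->
  H0 ip J f ->
  gradient_flow ip J f u ->
  let lam := lam1 * powR `|f| (p - 2) in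
  let w := fun t : R => (a_fun p lam t)^-1 *: u t in
  ((exists tk : nat -> R, tk @ \oo --> +oo /\ (fun k => w (tk k)) @ \oo --> w_star)
   \/ w @ +oo --> w_star) ->
  subdiff ip J w_star (lam *: w_star) /\ (2 < p -> w_star != 0).
Proof.
move=> hip Jc Jlsc Jp _ Jh _ lam1_gt0 p2 [_ f0] hu lam w hw.
have J0 := homogeneous_convex_ge0 Jp Jh Jc.
have lam0 : 0 < lam by rewrite mulr_gt0// powR_gt0// normr_gt0.
(* Both forms of convergence enter only through this cluster property. *)
have clu T e : 0 < e -> exists2 t, T <= t & `|w t - w_star| < e.
  move=> e0; case: hw => [[tk [/cvgryPge/(_ T) tkT /cvgrPdist_lt/(_ e e0) wk]]|].
    have [k [h1 h2]] := filter_ex (filterI tkT wk).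
    by exists (tk k) => //; rewrite distrC.
  move=> /cvgrPdist_lt/(_ e e0) we.
  have [t [h1 h2]] := filter_ex (filterI (nbhs_pinfty_ge (num_real T)) we).
  by exists t => //; rewrite distrC.
have q0 mu : 0 <= mu -> 0 <= (p - 2) * mu.
  by move=> ?; rewrite mulr_ge0// subr_ge0.
split.
  have [z [j [Wc Wd Wz Wj]]] := rescaled_flow_spec hip Jp Jh p2 hu (ltW lam0)
    (lexx 0) ler01 (ltr_wpDl (lexx 0) ltr01).
  apply: (cluster_subdiff hip Jlsc (ltW lam0) Wc Wd Wz Wj J0) => T e e0.
  (* The maximum with 1 puts [r] in the range where the rescaled flow is described. *)
  pose T' := Num.max 1 T.
  have [t Tt we] := clu (theta ((p - 2) * lam) T') e e0.
  have T'0 : 0 <= T' by rewrite le_max ler01.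
  have [r Tr tr] := theta_surj (q0 _ (ltW lam0)) T'0 Tt.
  have := Tr; rewrite ge_max => /andP[r1 rT].
  exists r; split => //; rewrite add0r tr.
  by move: we; rewrite /w -tr a_fun_theta// expRN invrK.
move=> p2'; apply/eqP => w0.
have [s s0 us] := gradient_flow_neq0 hu f0.
pose j0 := fine (J (u s)).
have j00 : 0 <= j0 by rewrite fine_ge0.
have us2 : 0 < `|u s| ^+ 2 by rewrite exprn_gt0// normr_gt0.
(* Chosen so that [mu / 2 * |u s|^2 = j0 + 1], that is, initial energy -1. *)
pose mu := 2 * (j0 + 1) / `|u s| ^+ 2.
have mu0 : 0 < mu by rewrite divr_gt0// mulr_gt0//; lra.
have sa : 0 < s + 0 by rewrite addr0.
have [z [j [Wc Wd Wz Wj]]] := rescaled_flow_spec hip Jp Jh p2 hu (ltW mu0)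
  (ltW s0) (lexx 0) sa.
have enonincr t t0 :=
  @energy_nonincr _ _ _ _ _ _ _ _ _ hip Jlsc Wc Wd Wz Wj 0 t (lexx 0) t0.
have [K K0 HK] := a_fun_comparable p2' lam0 mu0 (ltW s0).
(* Energy at most -1 and [J >= 0] force [mu / 2 * |W r|^2 >= 1], hence [|W r| >= c]. *)
pose c := Num.sqrt (2 / mu).
have c0 : 0 < c by rewrite sqrtr_gt0 divr_gt0.
have [t st] := clu s (c / K) (divr_gt0 c0 K0).
rewrite w0 subr0; apply/negP; rewrite -leNgt.
have ts0 : theta ((p - 2) * mu) 0 <= t - s by rewrite theta0 subr_ge0.
have [r r0 tr] := theta_surj (q0 _ (ltW mu0)) (lexx 0) ts0.
have cW : c <= `|expR (mu * r) *: u t|.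
  rewrite -(@ler_pXn2r _ 2) ?nnegrE ?(ltW c0)// sqr_sqrtr; last first.
    by rewrite divr_ge0// ltW.
  have := enonincr r r0; have := Wj 0 (lexx 0); have := Wj r r0.
  rewrite mulr0 expR0 scale1r theta0 addr0 tr addrC subrK => Jr Js.
  have -> : j 0 = j0 by rewrite /j0 Js.
  have jr0 : 0 <= j r by rewrite -lee_fin -Jr.
  have -> : mu / 2 * `|u s| ^+ 2 = j0 + 1.
    rewrite /mu; move: (_ ^+ 2) us2 => X X0; field; exact: lt0r_neq0.
  move=> le1; rewrite ler_pdivrMr//; lra.
have t0 : 0 <= t by exact: le_trans (ltW s0) st.
have at0 : 0 < a_fun p lam t by apply: a_fun_gt0.
(* The factor [expR (- (mu * r))] is common to [|u t|] and to the bound on [a_fun p lam t];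
   cancelling it leaves [|w t| >= c / K]. *)
rewrite /w normrZ ger0_norm ?invr_ge0 ?(ltW at0)// ler_pdivrMr//.
rewrite -mulrA ler_pdivlMl//.
have := HK t st; rewrite -tr a_fun_theta// => aK.
have -> : `|u t| = expR (- (mu * r)) * `|expR (mu * r) *: u t|.
  by rewrite normrZ (ger0_norm (expR_ge0 _)) mulrA -expRD addNr expR0 mul1r.
apply: le_trans (ler_wpM2r (ltW c0) aK) _.
rewrite [leRHS]mulrC mulrA ler_pM2l//; exact: mulr_gt0 (expR_gt0 _).
Qed.
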